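(* Let $(\Omega,\mathcal A,P)$ be a complete probability space, $g\in L^1(\mathbb R)$, and let $\varphi\colon\mathbb R\times\Omega\to\mathbb R$ satisfy conditions (a), (b), (c) listed in the context. Let $F\subset\mathbb R$ be a closed and non-degenerate interval such that $\operatorname{supp} g\subset F$ and $$\varphi(\operatorname{int}F\times\{\omega\})=\operatorname{int}F\quad\text{for almost all }\omega\in\Omega.$$ Then the equation $$f(x)=\int_\Omega|\varphi'_x(x,\omega)|f(\varphi(x,\omega))\,P(d\omega)+g(x)$$ has a compactly supported $L^1(\mathbb R)$-solution $f$ with $\operatorname{supp}f\subset F$ if and only if there exists a diffeomorphism $\alpha\colon\mathbb R\to\operatorname{int}F$ (onto $\operatorname{int}F$) such that the equation $$\widetilde f(x)=\int_\Omega|\phi'_x(x,\omega)|\widetilde f(\phi(x,\omega))\,P(d\omega)+\widetilde g(x),$$ with $\widetilde g=|\alpha'|\cdot (g\circ\alpha)$ and $\phi\colon\mathbb R\times\Omega\to\mathbb R$ given (for almost all $\omega$) by $\phi(x,\omega)=\alpha^{-1}(\varphi(\alpha(x),\omega))$, has an $L^1(\mathbb R)$-solution $\widetilde f$.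
   Context: Conditions on $\varphi$: (a) $\varphi(\cdot,\omega)$ is a diffeomorphism from $\mathbb R$ onto $\mathbb R$ for every $\omega\in\Omega$; (b) $\varphi(x,\cdot)$ is $\mathcal A$-measurable for every $x\in\mathbb R$; (c) $(\lambda\otimes P)(\varphi^{-1}(B))=0$ for every Borel set $B\subset\mathbb R$ with $\lambda(B)=0$, where $\lambda$ is Lebesgue measure. $\varphi'_x$ and $\phi'_x$ denote derivatives with respect to the first variable. A function $f\in L^1(\mathbb R)$ is an $L^1(\mathbb R)$-solution of such an equation if every representative of $f$ satisfies it for Lebesgue-almost all $x\in\mathbb R$.
   Formalization: The ''if'' direction is stated only for bounded F (the ''only if'' for every F): for F=ℝ, φ(x,ω)=−x, g(x)=x·exp(−x²), α=id, the function g/2 solves the second equation, but no compactly supported f solves the first. *)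

(* Defs.v *)
From HB Require Import structures.
From mathcomp Require Import all_boot all_order all_algebra.
From mathcomp Require Import all_classical all_reals all_analysis.

Set Implicit Arguments.
Unset Strict Implicit.
Unset Printing Implicit Defensive.

Import Order.TTheory GRing.Theory Num.Theory.
Import numFieldNormedType.Exports.

Local Open Scope classical_set_scope.
Local Open Scope ring_scope.

Notation lambda R := (@lebesgue_measure R).

Section Diffeomorphisms.
Context {R : realType}.
Implicit Types (U V : set R) (f : R -> R).

(* Meant for open U, where the library's two-sided derivative is the right
   one at every point of U. *)
Definition continuously_differentiable_on U f : Prop :=
  forall x, U x -> derivable f x 1 /\ {for x, continuous (derive1 f)}.

(* f is a C^1-diffeomorphism from the open set U onto the open set V; on V,
   pinv U f is the inverse of f. *)
Definition diffeomorphism U V f : Prop :=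
  [/\ set_bij U V f,
      continuously_differentiable_on U f &
      continuously_differentiable_on V (pinv U f)].

End Diffeomorphisms.

Section L1Functions.
Context {R : realType}.

(* An element of L^1(R) is given by one Borel representative; its
   representatives are all functions h (not necessarily Borel, hence all
   Lebesgue measurable ones) with h = f %[ae lambda R]. *)
Definition L1 (f : R -> R) : Prop := f \in Lfun (lambda R) 1.

(* Support of the class of f: complement of the largest open set on which
   f = 0 almost everywhere. *)
Definition ess_support (f : R -> R) : set R :=
  [set x | forall U, nbhs x U ->
     ~ {ae lambda R, forall y, U y -> f y = 0}].

End L1Functions.

Section Equation.
Context {R : realType} {d : measure_display} {Omega : measurableType d}.
Variable P : probability Omega R.
Implicit Types (phi psi : R -> Omega -> R) (f g h : R -> R) (F : set R).

Definition admissible phi : Prop :=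
  [/\ forall w, diffeomorphism setT setT (phi ^~ w),
      forall x, measurable_fun setT (phi x) &
      forall B : set R, measurable B -> lambda R B = 0%E ->
        (lambda R \x P)%E [set z : R * Omega | B (phi z.1 z.2)] = 0%E].

Definition equation_at phi g h (x : R) : Prop :=
  let integrand w := (`|derive1 (phi ^~ w) x| * h (phi x w))%:E in
  P.-integrable setT integrand /\
  (h x)%:E = (\int[P]_w integrand w + (g x)%:E)%E.

Definition L1_solution phi g f : Prop :=
  L1 f /\
  forall h, h = f %[ae lambda R] ->
    {ae lambda R, forall x, equation_at phi g h x}.

(* When F is bounded the compactness below is automatic. When F is unbounded,
   solution_after_conjugation does not imply compact_solution_within: take
   F = setT, phi x w = - x, g x = x * expR (- x ^+ 2) and alpha = id. Then g / 2
   is an L^1-solution, but a compactly supported solution f would force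
   g x = f x - f (- x) to be compactly supported. *)
Definition compact_solution_within phi g F : Prop :=
  exists f, [/\ L1_solution phi g f, compact (ess_support f)
              & ess_support f `<=` F].

(* For the exceptional w the values of psi are arbitrary. *)
Definition conjugate_by (alpha : R -> R) phi psi : Prop :=
  {ae P, forall w, forall x, psi x w = pinv setT alpha (phi (alpha x) w)}.

Definition solution_after_conjugation phi g F : Prop :=
  exists alpha, diffeomorphism setT F° alpha /\
  exists psi, conjugate_by alpha phi psi /\
  exists f, L1_solution psi (fun x => `|derive1 alpha x| * g (alpha x)) f.

End Equation.

(* Main.v *)
Require Import Defs.
From HB Require Import structures.
From mathcomp Require Import all_boot all_order all_algebra.
From mathcomp Require Import all_classical all_reals all_analysis.
From mathcomp Require Import measurable_realfun ring lra.
Import Order.TTheory GRing.Theory Num.Theory.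
Import numFieldNormedType.Exports.
Local Open Scope classical_set_scope.
Local Open Scope ring_scope.

Set Implicit Arguments.
Unset Strict Implicit.
Unset Printing Implicit Defensive.

(** Conjugation by a diffeomorphism [alpha] of the line onto the interior of
    [F] turns the equation on [F] into the equation on the line. If
    [ft = |alpha'| (f o alpha)], multiply the equation for [f] at [alpha x] by
    [|alpha' x|]. By the chain rule the new integrand is
    [|psi'_x (x, w)| ft (psi (x, w))], where
    [psi (x, w) = alpha^-1 (phi (alpha x, w))], for every [w] whose map
    preserves the interior, and the new free term is [|alpha'| (g o alpha)]. So the two
    equations are equivalent point by point ([equation_at_conjugate]); the
    completeness of the probability allows the exceptional [w] to be ignored.

    What remains is that this correspondence respects null sets and
    integrability. Both follow from the change of variables
    [lebesgue_measure_diffeo_image], which says that [alpha] takes the measure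
    with density [|alpha'|] to Lebesgue measure on the interior: null sets are
    carried to null sets in both directions ([ae_comp_diffeo],
    [ae_diffeo_comp]), and [f |-> |alpha'| (f o alpha)] and its inverse
    preserve integrability ([L1_pullback], [L1_pushforward]).

    In the forward direction any [alpha] will do, and one exists by
    [diffeomorphism_interior]. In the converse, a solution on the line is
    transported to the interior of [F] and extended by zero; its support is then
    a closed subset of [F], compact when [F] is bounded. The equation outside
    [F] must also be checked for every representative of this extension; there
    the assumption that [phi] pulls null sets back to null sets of the product,
    through Fubini ([ae_fiber]), ensures that for almost every
    [x] a change on a null set is not seen by [phi x w] for almost all [w]. *)

(** * Calculus of diffeomorphisms of the line *)

Section DiffeomorphismCalculus.
Context {R : realType} (V : set R) (alpha : R -> R).
Hypothesis alphaD : diffeomorphism setT V alpha.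
Local Notation beta := (pinv (@setT R) alpha).

Lemma diffeo_inj : injective alpha.
Proof.
by case: alphaD => -[_ aI _] _ _ x y; apply: aI; rewrite inE.
Qed.

Lemma diffeo_mem x : V (alpha x).
Proof. by case: alphaD => -[aV _ _] _ _; exact: aV. Qed.

Lemma diffeoK : cancel alpha beta.
Proof.
move=> x; apply: pinvKV; last exact/mem_set.
by move=> y z _ _; exact: diffeo_inj.
Qed.

Lemma diffeoVK y : V y -> alpha (beta y) = y.
Proof. by case: alphaD => -[_ _ aV] _ _ /mem_set; exact: surjpK aV _. Qed.

(** Images under [alpha] are preimages under its inverse, hence inherit the
    measurability of preimages. The inverse is replaced by any [g] that agrees
    with it on [V], because [pinv] is uncontrolled outside [V]. *)
Lemma diffeo_image (A : set R) (g : R -> R) :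
  (forall y, V y -> g y = beta y) -> alpha @` A = g @^-1` A `&` V.
Proof.
move=> gE; apply/seteqP; split=> [_ [x Ax <-]|y [/= Ay Vy]].
  by split; rewrite /= ?gE ?diffeoK//; exact: diffeo_mem.
by exists (beta y); rewrite -?gE// gE// diffeoVK.
Qed.

Lemma diffeo_derivable x : derivable alpha x 1.
Proof. by case: alphaD => _ /(_ x I)[]. Qed.

Lemma diffeo_continuous : continuous alpha.
Proof.
by move=> x; apply/differentiable_continuous/derivable1_diffP/diffeo_derivable.
Qed.

Lemma diffeo_continuous_derive1 : continuous (derive1 alpha).
Proof. by move=> x; case: alphaD => _ /(_ x I)[]. Qed.

Lemma diffeoV_derivable y : V y -> derivable beta y 1.
Proof. by move=> Vy; case: alphaD => _ _ betaD; exact: (betaD y Vy).1. Qed.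

Lemma derive1_diffeoV x : derive1 beta (alpha x) * derive1 alpha x = 1.
Proof.
rewrite -derive1_comp; last 2 first.
- exact: diffeo_derivable.
- exact/diffeoV_derivable/diffeo_mem.
rewrite (_ : beta \o alpha = id) ?derive1_id//.
by apply/funext => z /=; rewrite diffeoK.
Qed.

Lemma derive1_diffeo_neq0 x : derive1 alpha x != 0.
Proof.
apply/eqP => a0; have := derive1_diffeoV x.
by rewrite a0 mulr0 => /eqP; rewrite eq_sym oner_eq0.
Qed.

Lemma jacobian_gt0 x : 0 < `|derive1 alpha x|.
Proof. by rewrite normr_gt0 derive1_diffeo_neq0. Qed.

Lemma jacobianV x : `|derive1 beta (alpha x)| = `|derive1 alpha x|^-1.
Proof.
apply: (mulIf (lt0r_neq0 (jacobian_gt0 x))).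
by rewrite -normrM derive1_diffeoV normr1 mulVf// lt0r_neq0// jacobian_gt0.
Qed.

(** The derivative is continuous and never vanishes, so by the intermediate
    value theorem it has one sign [s]; the fundamental theorem of calculus,
    which knows only the signed derivative, then also integrates the Jacobian
    [|alpha'|]. *)
Lemma derive1_diffeo_sign : exists s : R, `|s| = 1 /\
  forall x, `|derive1 alpha x| = s * derive1 alpha x.
Proof.
pose s := Num.sg (derive1 alpha 0); exists s; split.
  by rewrite normr_sg derive1_diffeo_neq0.
suff sE x : Num.sg (derive1 alpha x) = s by move=> x; rewrite -(sE x) -normrEsg.
apply/eqP; apply/negPn/negP => sx.
have cd a b : {within `[a, b], continuous (derive1 alpha)}.
  by apply: continuous_subspaceT; exact: diffeo_continuous_derive1.
have nz := derive1_diffeo_neq0.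
have between : Num.min (derive1 alpha 0) (derive1 alpha x) <= 0 <=
    Num.max (derive1 alpha 0) (derive1 alpha x).
  rewrite ge_min le_max.
  move: sx; rewrite /s; have := nz x; have := nz 0.
  have [a0|a0|->] := ltrgtP (derive1 alpha 0) 0; rewrite ?eqxx// => _.
    have [b0|b0|->] := ltrgtP (derive1 alpha x) 0; rewrite ?eqxx// => _.
    by rewrite (ltr0_sg a0) (ltr0_sg b0) eqxx.
  have [b0|b0|->] := ltrgtP (derive1 alpha x) 0; rewrite ?eqxx// => _.
  by rewrite (gtr0_sg a0) (gtr0_sg b0) eqxx.
have [x0|x0] := leP 0 x.
  have [c _ c0] := IVT x0 (cd _ _) between.
  by have := nz c; rewrite c0 eqxx.
rewrite minC maxC in between.
have [c _ c0] := IVT (ltW x0) (cd _ _) between.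
by have := nz c; rewrite c0 eqxx.
Qed.

(** Applied with [u] the map [phi ^~ w], this is the derivative of the map
    [psi ^~ w] of the conjugated equation. *)
Lemma derive1_conjugate (u : R -> R) x :
  derivable u (alpha x) 1 -> V (u (alpha x)) ->
  derive1 (beta \o u \o alpha) x =
  derive1 beta (u (alpha x)) * derive1 u (alpha x) * derive1 alpha x.
Proof.
move=> du Vu; have da := @diffeo_derivable x.
have dua : derivable (u \o alpha) x 1.
  apply/derivable1_diffP/differentiable_comp.
    exact: (derivable1_diffP alpha x).1 da.
  exact: (derivable1_diffP u (alpha x)).1 du.
rewrite -compA (derive1_comp dua (@diffeoV_derivable _ Vu)) -mulrA.
by congr (_ * _); exact: derive1_comp da du.
Qed.

End DiffeomorphismCalculus.
Arguments diffeo_derivable {R V alpha} alphaD x.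
Arguments diffeoV_derivable {R V alpha} alphaD {y} Vy.

(** * Measures with a density *)

Section Density.
Local Open Scope ereal_scope.
Context d (T : measurableType d) (R : realType).
Variables (mu : {measure set T -> \bar R}) (w : T -> R).

(** The proofs [mw] and [w0] are arguments so that the measure structure can be
    attached to the function itself. *)
Definition with_density (mw : measurable_fun setT w)
    (w0 : forall x, (0 <= w x)%R) :=
  fun A : set T => \int[mu]_(x in A) (w x)%:E.

Hypotheses (mw : measurable_fun setT w) (w0 : forall x, (0 <= w x)%R).

Let with_density0 : with_density mw w0 set0 = 0.
Proof. by rewrite /with_density integral_set0. Qed.

Let with_density_ge0 A : 0 <= with_density mw w0 A.
Proof. by apply: integral_ge0 => x _; rewrite lee_fin. Qed.

Let with_density_sigma_additive : semi_sigma_additive (with_density mw w0).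
Proof.
apply: semi_sigma_additive_nng_induced; first exact/measurable_EFinP.
by move=> x; rewrite lee_fin.
Qed.

HB.instance Definition _ := isMeasure.Build _ _ _ (with_density mw w0)
  with_density0 with_density_ge0 with_density_sigma_additive.

Import HBNNSimple.

(** Both sides are monotone limits along simple functions approximating [f],
    and on an indicator the equality is the hypothesis on [nu]. *)
Lemma ge0_integral_density (nu : {measure set T -> \bar R}) (f : T -> \bar R) :
  (forall A, measurable A -> nu A = \int[mu]_(x in A) (w x)%:E) ->
  measurable_fun setT f -> (forall x, 0 <= f x) ->
  \int[nu]_x f x = \int[mu]_x ((w x)%:E * f x).
Proof.
move=> nuE mf f0; pose f_ := nnsfun_approx measurableT mf.
have f_f x : (f_ n x)%:E @[n --> \oo] --> f x.
  by apply: cvg_nnsfun_approx.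
have f_nd x : nondecreasing_seq (fun n => (f_ n x)%:E).
  by move=> m n mn; rewrite lee_fin; exact/lefP/nd_nnsfun_approx.
have mEw : measurable_fun setT (EFin \o w) by exact/measurable_EFinP.
transitivity (limn (fun n => \int[nu]_x (f_ n x)%:E)).
  rewrite -monotone_convergence//.
  - by apply: eq_integral => x _; apply/esym/cvg_lim => //; exact: f_f.
  - by move=> n; exact/measurable_EFinP.
  - by move=> n x _; rewrite lee_fin.
transitivity (limn (fun n => \int[mu]_x ((w x)%:E * (f_ n x)%:E))); last first.
  rewrite -monotone_convergence//.
  - by apply: eq_integral => x _; apply/cvg_lim => //; exact: cvgeZl.
  - move=> n; apply: emeasurable_funM => //; exact/measurable_EFinP.
  - by move=> n x _; rewrite mule_ge0// lee_fin.
  - by move=> x _ m n mn; rewrite lee_wpmul2l ?lee_fin//; exact: f_nd.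
congr (limn _); apply/funext => n.
rewrite integralT_nnsfun sintegralE; under [RHS]eq_integral => x _.
  rewrite fimfunE -fsumEFin// ge0_mule_fsumr; last first.
    by move=> r; exact: nnfun_muleindic_ge0.
  over.
rewrite ge0_integral_fsum//; last 2 first.
- move=> r; apply: emeasurable_funM => //; apply/measurable_EFinP.
  exact: measurable_funM.
- by move=> r x _; rewrite mule_ge0 ?lee_fin//; exact: nnfun_muleindic_ge0.
apply: eq_fsbigr => r; rewrite inE => -[x0 _ rE].
have r0 : (0 <= r)%R by rewrite -rE fun_ge0.
under eq_integral do rewrite EFinM muleCA.
rewrite ge0_integralZl ?lee_fin//; last 2 first.
- by apply: emeasurable_funM => //; exact/measurable_EFinP.
- by move=> x _; rewrite mule_ge0 ?lee_fin.
congr (_ * _); rewrite nuE//.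
by rewrite integral_mkcond epatch_indic.
Qed.

End Density.

(** * Change of variables on the line *)

Section ChangeOfVariables.
Context {R : realType} (V : set R) (alpha : R -> R).
Hypotheses (V_open : open V) (alphaD : diffeomorphism setT V alpha).
Local Notation beta := (pinv (@setT R) alpha).
Local Notation jac := (fun x : R => `|derive1 alpha x|).

Lemma measurable_jacobian : measurable_fun setT jac.
Proof.
apply: measurableT_comp => //; apply: continuous_measurable_fun.
exact: diffeo_continuous_derive1 alphaD.
Qed.

Lemma measurable_diffeoV : measurable_fun V beta.
Proof.
apply: open_continuous_measurable_fun => // y /[!inE] Vy.
apply/differentiable_continuous/derivable1_diffP.
exact: (diffeoV_derivable alphaD Vy).
Qed.

Lemma integral_jacobian_itv x y : x < y ->
  (\int[lambda R]_(t in `]x, y]) (jac t)%:E = `|alpha y - alpha x|%:E)%E.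
Proof.
move=> xy; have mE := (measurable_EFinP _ _).2 measurable_jacobian.
have [s [s1 sE]] := derive1_diffeo_sign alphaD.
have I0 : (0 <= \int[lambda R]_(t in `]x, y]) (jac t)%:E)%E.
  by apply: integral_ge0 => t _; rewrite lee_fin.
have IE : (\int[lambda R]_(t in `]x, y]) (jac t)%:E =
    (s * alpha y)%:E - (s * alpha x)%:E)%E.
  rewrite integral_itv_obnd_cbnd; last exact: measurable_funTS.
  apply: (@continuous_FTC2 R jac (fun t => s * alpha t)) => //.
  - apply: continuous_subspaceT => t.
    apply: continuous_comp; last exact: norm_continuous.
    exact: diffeo_continuous_derive1 alphaD _.
  - have sc : continuous (fun t => s * alpha t).
      move=> t; apply: continuousM; first exact: cst_continuous.
      exact: diffeo_continuous alphaD _.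
    split.
    + move=> t _; apply: derivableM; first exact: derivable_cst.
      exact: diffeo_derivable alphaD _.
    + apply: cvg_at_right_filter; exact: sc.
    + apply: cvg_at_left_filter; exact: sc.
  - move=> t _; rewrite derive1Ml; last exact: diffeo_derivable alphaD _.
    by rewrite sE.
move: I0; rewrite IE -EFinB -mulrBr lee_fin => I0.
by rewrite -(ger0_norm I0) normrM s1 mul1r.
Qed.

(** A continuous injection maps [`[x, y]] onto the segment between the two
    values, in whichever order they come. *)
Lemma lebesgue_measure_diffeo_itv x y : x < y ->
  (lambda R (alpha @` `]x, y]%classic) = `|alpha y - alpha x|%:E)%E.
Proof.
move=> xy; have aI := diffeo_inj alphaD.
have -> : alpha @` `]x, y]%classic =
    [set` alpha @`[x, y]] `\` [set alpha x].
  rewrite -(continuous_inj_image_segment (ltW xy)); last 2 first.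
  - exact/continuous_subspaceT/(diffeo_continuous alphaD).
  - by move=> ? ? _ _; exact: aI.
  apply/seteqP; split=> [_ [t /= txy <-]|_ [[t txy <-] /= tx]].
    split; first by exists t => //; exact: subset_itv_oc_cc.
    by move=> /= /aI tx; move: txy; rewrite tx in_itv/= ltxx.
  exists t => //=; move: txy; rewrite /= !in_itv/= !le_eqVlt.
  by case/andP => /predU1P[xt|-> ->//]; rewrite xt in tx.
rewrite measureD//=; last first.
- by rewrite lebesgue_measure_itv/=; case: ifP => _; rewrite // ltry.
rewrite [X in (_ - X)%E](_ : _ = 0%E) ?sube0; last first.
  apply: subset_measure0 (lebesgue_measure_set1 (alpha x)) => //.
  by apply: measurableI => //; exact: measurable_itv.
rewrite lebesgue_measure_itv/= lte_fin.
have [axy|axy|/aI axy] := ltrgtP (alpha x) (alpha y).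
- by rewrite axy.
- by rewrite axy.
- by rewrite axy ltxx in xy.
Qed.

(* The inverse extended by 0, so that it is measurable on the whole line. *)
Let g : measurableTypeR R -> measurableTypeR R := beta \_ V.

Let mV : measurable (V : set (measurableTypeR R)) := open_measurable V_open.

Let mg : measurable_fun setT g.
Proof. by apply: (measurable_restrictT _ mV).1; exact: measurable_diffeoV. Qed.

Let image_diffeo A : alpha @` A = g @^-1` A `&` V.
Proof.
apply: (diffeo_image alphaD) => y Vy; by rewrite /g patchE mem_set.
Qed.

Lemma measurable_diffeo_image A : measurable A -> measurable (alpha @` A).
Proof.
move=> mA; rewrite image_diffeo; apply: measurableI => //.
by rewrite -[X in measurable X]setTI; exact: mg.
Qed.

(** Both sides are measures in [A]: the left one is Lebesgue measure on [V]
    transported by the inverse, the right one has density [|alpha'|]. They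
    agree on the half-open intervals, which generate the Borel sets. *)
Lemma lebesgue_measure_diffeo_image A : measurable A ->
  lambda R (alpha @` A) = (\int[lambda R]_(x in A) (jac x)%:E)%E.
Proof.
move=> mA; rewrite image_diffeo.
have jac0 x : 0 <= jac x by [].
pose m1 : {measure set (measurableTypeR R) -> \bar R} :=
  (measure_function_pushforward__canonical__measure_function_Measure
    (mrestr (lambda R) mV) mg).
pose m2 : {measure set (measurableTypeR R) -> \bar R} :=
  with_density (lambda R) measurable_jacobian jac0.
have m1E B : m1 B = lambda R (alpha @` B) by rewrite image_diffeo.
rewrite -[LHS]/(m1 A) -[RHS]/(m2 A).
apply: (@measure_unique _ R (measurableTypeR R) (@ocitv R)
  (fun k => `](- k%:R), k%:R]%classic)) => //.
- exact: ocitvI.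
- by move=> k; exact: is_ocitv.
- exact: bigcup_itvT.
- move=> _ /ocitvP[->|[[x y] /= xy ->]]; first by rewrite !measure0.
  rewrite m1E lebesgue_measure_diffeo_itv//; exact/esym/integral_jacobian_itv.
- move=> [|k]; first by rewrite oppr0 set_itvoc0 measure0.
  by rewrite m1E lebesgue_measure_diffeo_itv ?ltry// gtrN.
Qed.

Lemma ge0_change_of_variables (f : R -> \bar R) :
  measurable_fun setT f -> (forall x, (0 <= f x)%E) ->
  (\int[lambda R]_(y in V) f (beta y) = \int[lambda R]_x ((jac x)%:E * f x))%E.
Proof.
move=> mf f0.
pose m1 : {measure set (measurableTypeR R) -> \bar R} :=
  (measure_function_pushforward__canonical__measure_function_Measure
    (mrestr (lambda R) mV) mg).
have jac0 x : 0 <= jac x by [].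
have m1E A : measurable A -> m1 A = (\int[lambda R]_(x in A) (jac x)%:E)%E.
  by move=> mA; rewrite -lebesgue_measure_diffeo_image// image_diffeo.
rewrite -(@ge0_integral_density _ (measurableTypeR R) R (lambda R) jac
  measurable_jacobian jac0 m1 f m1E mf f0).
rewrite [LHS](_ : _ = \int[lambda R]_x ((\1_V x)%:E * f (g x)))%E; last first.
  rewrite integral_mkcond epatch_indic; apply: eq_integral => y _ /=.
  rewrite muleC; have [yV|yV] := boolP (y \in V); last first.
    by rewrite indicE (negbTE yV) !mul0e.
  by rewrite /g patchE yV.
rewrite /m1 ge0_integral_pushforward//.
rewrite preimage_setT.
rewrite (@ge0_integral_density _ _ _ (lambda R) (\1_V : R -> R))//.
- by move=> A mA; rewrite integral_indic//= setIC.
- exact: measurableT_comp.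
- by move=> x; exact: f0.
Qed.

(** The preimage [B] of a null set is null: the integral of [|alpha'|] over
    [B] is the measure of [alpha @` B], which is zero, and [|alpha'|] is
    positive. *)
Lemma ae_comp_diffeo (Q : R -> Prop) :
  (\forall y \ae lambda R, Q y) -> \forall x \ae lambda R, Q (alpha x).
Proof.
move=> [A [mA A0 QA]]; pose B := alpha @^-1` A.
have mB : measurable (B : set (measurableTypeR R)).
  rewrite -[X in measurable X]setTI.
  exact: (continuous_measurable_fun (diffeo_continuous alphaD)).
exists B; split=> //; last by move=> x /= nQ; exact: QA.
have : (\int[lambda R]_(x in B) `|(jac x)%:E| = 0)%E.
  rewrite -[LHS]/(\int[lambda R]_(x in B) (`|jac x|)%:E)%E.
  under eq_integral do rewrite normr_id.
  rewrite -lebesgue_measure_diffeo_image//.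
  apply: subset_measure0 A0 => //; first exact: measurable_diffeo_image.
  by move=> _ [x Bx <-].
move/(ae_eq_integral_abs _ mB
  (measurable_funTS ((measurable_EFinP _ _).2 measurable_jacobian))).1.
move=> [N [mN N0 BN]]; apply: subset_measure0 N0 => // x Bx.
apply: BN => /= /(_ Bx) [] /eqP.
by rewrite gt_eqF//; exact: jacobian_gt0 alphaD _.
Qed.

Lemma ae_diffeo_comp (Q : R -> Prop) :
  (\forall x \ae lambda R, Q (alpha x)) -> \forall y \ae lambda R, V y -> Q y.
Proof.
move=> [A [mA A0 QA]]; exists (alpha @` A); split.
- exact: measurable_diffeo_image.
- rewrite lebesgue_measure_diffeo_image//.
  apply: null_set_integral => //.
  exact: measurable_funTS ((measurable_EFinP _ _).2 measurable_jacobian).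
- move=> y /= /not_implyP[Vy nQ]; exists (beta y); last exact: diffeoVK Vy.
  by apply: QA => /=; rewrite (diffeoVK alphaD Vy).
Qed.

(** Change of variables turns the norm of [|alpha'| (f o alpha)] into the
    integral of [|f|] over [V]; in the next lemma the factor
    [|(alpha^-1)'| o alpha] cancels [|alpha'|], so that the norm is that of
    [f]. *)
Lemma L1_pullback f : L1 f -> L1 (fun x => `|derive1 alpha x| * f (alpha x)).
Proof.
move=> /Lfun1_integrable/integrableP[mf fI].
have mfR : measurable_fun setT f by exact/measurable_EFinP.
have mEf : measurable_fun setT (EFin \o f) by exact/measurable_EFinP.
have ma := continuous_measurable_fun (diffeo_continuous alphaD).
have mfa : measurable_fun setT (f \o alpha) by exact: measurableT_comp.
apply/Lfun1_integrable/integrableP; split.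
  apply/measurable_EFinP; apply: measurable_funM => //.
  exact: measurable_jacobian.
apply: le_lt_trans fI.
pose F x := `|(f (alpha x))%:E|%E.
have mF : measurable_fun setT F.
  rewrite (_ : F = abse \o (EFin \o (f \o alpha)))//.
  by apply: measurableT_comp => //; exact/measurable_EFinP.
have -> : (\int[lambda R]_x `|(`|derive1 alpha x| * f (alpha x))%:E| =
    \int[lambda R]_x ((jac x)%:E * F x))%E.
  by apply: eq_integral => x _; rewrite /F /= -EFinM normrM normr_id.
have F0 x : (0 <= F x)%E by exact: abse_ge0.
rewrite -(ge0_change_of_variables mF F0).
rewrite [leLHS](_ : _ = \int[lambda R]_(y in V) `|(f y)%:E|)%E; last first.
  by apply: eq_integral => y /[!inE] Vy; rewrite /F (diffeoVK alphaD Vy).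
apply: ge0_subset_integral => //.
exact: (measurableT_comp (@abse_measurable R setT) mf).
Qed.

Lemma L1_pushforward f : L1 f ->
  L1 (patch (fun=> 0) V (fun y => `|derive1 beta y| * f (beta y))).
Proof.
move=> /Lfun1_integrable/integrableP[mf fI].
have mfR : measurable_fun setT f by exact/measurable_EFinP.
have mk : measurable_fun V (fun y => `|derive1 beta y| * f (beta y)).
  apply: measurable_funM.
    apply: measurableT_comp => //.
    apply: open_continuous_measurable_fun => // y /[!inE] Vy.
    by case: alphaD => _ _ /(_ y Vy)[].
  by apply: measurableT_comp => //; exact: measurable_diffeoV.
apply/Lfun1_integrable/integrableP; split.
  apply/measurable_EFinP.
  exact: (measurable_restrictT _ mV).1 mk.
apply: le_lt_trans fI.
pose F x := `|((jac x)^-1 * f x)%:E|%E.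
rewrite [leLHS](_ : _ = \int[lambda R]_(y in V) F (beta y))%E; last first.
  rewrite [RHS]integral_mkcond; apply: eq_integral => y _.
  rewrite /= !patchE; case: ifPn => yV /=; last exact: (congr1 EFin (normr0 R)).
  have Vy := set_mem yV.
  rewrite /F /= -(jacobianV alphaD) (diffeoVK alphaD Vy).
  by rewrite !normrM normr_id.
have mF : measurable_fun setT F.
  rewrite (_ : F = abse \o (EFin \o (fun x => (jac x)^-1 * f x)))//.
  apply: measurableT_comp => //; apply/measurable_EFinP.
  apply: measurable_funM => //.
  apply: continuous_measurable_fun => x; apply: (@cvgV _ _ _ _ jac).
    by rewrite gt_eqF//; exact: jacobian_gt0 alphaD _.
  apply: continuous_comp; last exact: norm_continuous.
  exact: diffeo_continuous_derive1 alphaD _.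
have F0 x : (0 <= F x)%E by exact: abse_ge0.
rewrite (ge0_change_of_variables mF F0).
rewrite le_eqVlt; apply/orP; left; apply/eqP; apply: eq_integral => x _.
rewrite /F /= -EFinM normrM normrV ?unitfE ?normr_eq0; last first.
  exact: derive1_diffeo_neq0 alphaD _.
rewrite normr_id mulrA divff ?mul1r// normr_eq0.
exact: derive1_diffeo_neq0 alphaD _.
Qed.

End ChangeOfVariables.

(** * Conjugating the equation *)

Section Conjugation.
Context {R : realType} {d : measure_display} {Omega : measurableType d}.
Variable P : probability Omega R.
Hypothesis P_complete : measure_is_complete P.

(** The completeness of [P] makes [f'] measurable; an integrand known only for
    almost all [w] may therefore be replaced by any other version. *)
Lemma integrable_ae_eq (f f' : Omega -> \bar R) : f = f' %[ae P] ->
  P.-integrable setT f -> P.-integrable setT f' /\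
    (\int[P]_w f' w = \int[P]_w f w)%E.
Proof.
move=> ff' fI; have mf := measurable_int _ fI.
have mf' : measurable_fun setT f' := ae_measurable_fun P_complete ff' mf.
have f'f : f' = f %[ae P] by apply: filterS ff' => w /[apply].
split; last exact: ae_eq_integral f'f.
move/integrableP : fI => [_ fI]; apply/integrableP; split=> //.
rewrite (ae_eq_integral (abse \o f))//.
- exact: measurableT_comp.
- exact: measurableT_comp.
- by apply: filterS f'f => w /= /[apply] ->.
Qed.

Variables (V : set R) (alpha : R -> R).
Hypothesis alphaD : diffeomorphism setT V alpha.
Variables (phi psi : R -> Omega -> R) (g : R -> R).
Hypotheses (phiD : forall w, diffeomorphism setT setT (phi ^~ w))
  (phi_V : {ae P, forall w, (phi ^~ w) @` V = V})
  (psiE : conjugate_by P alpha phi psi).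

(** For fixed [x], the conjugated equation at [x] is the original one at
    [alpha x] multiplied by [|alpha' x|]. With [j] the Jacobian of [alpha] at
    [psi x w], the chain rule contributes [j^-1] and [k] contributes [j], so
    the integrands are proportional for almost all [w]. The statement is
    pointwise and holds for arbitrary [h] and [k], measurable or not, as the
    quantification over all representatives requires. *)
Lemma equation_at_conjugate (h k : R -> R) (x : R) :
  (forall y, k y = `|derive1 alpha y| * h (alpha y)) ->
  equation_at P phi g h (alpha x) <->
  equation_at P psi (fun y => `|derive1 alpha y| * g (alpha y)) k x.
Proof.
move=> kE; set c := `|derive1 alpha x|.
have c0 : c != 0 by rewrite gt_eqF//; exact: jacobian_gt0 alphaD _.
pose I w := (`|derive1 (phi ^~ w) (alpha x)| * h (phi (alpha x) w))%:E.
pose J w := (`|derive1 (psi ^~ w) x| * k (psi x w))%:E.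
have IJ : (fun w => c%:E * I w)%E = J %[ae P].
  near=> w => _.
  have phiV : (phi ^~ w) @` V = V by near: w.
  have psiw : forall x, psi x w = pinv setT alpha (phi (alpha x) w) by near: w.
  have Vphi : V (phi (alpha x) w).
    by rewrite -phiV; exists (alpha x) => //; exact: diffeo_mem alphaD _.
  have psiwE : psi ^~ w = pinv (@setT R) alpha \o phi ^~ w \o alpha.
    by apply/funext => y; rewrite psiw.
  rewrite /I /J psiwE -EFinM kE.
  rewrite (derive1_conjugate alphaD (diffeo_derivable (phiD w) _) Vphi).
  have -> : psi x w = pinv (@setT R) alpha (phi (alpha x) w) by rewrite psiw.
  congr (_%:E); have aK := diffeoVK alphaD Vphi.
  have := jacobianV alphaD (pinv (@setT R) alpha (phi (alpha x) w)).
  rewrite aK !normrM => ->; set j := `|derive1 alpha (pinv _ _ _)|.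
  have j0 : j != 0 by rewrite gt_eqF//; exact: jacobian_gt0 alphaD _.
  rewrite -/c; field.
  exact: j0.
have JI : (fun w => c^-1%:E * J w)%E = I %[ae P].
  apply: filterS IJ => w /(_ Logic.I) <- _.
  by rewrite /I -!EFinM mulrA mulVf// mul1r.
split=> -[iI E].
- have iI' : P.-integrable setT (fun w => c%:E * I w)%E by exact: integrableZl.
  have [iJ JE] := integrable_ae_eq IJ iI'; split=> //.
  by rewrite JE integralZl// kE -/c EFinM E muleDr ?fin_num_adde_defl//.
- have iJ' : P.-integrable setT (fun w => c^-1%:E * J w)%E.
    exact: integrableZl.
  have [iI' IE] := integrable_ae_eq JI iJ'; split=> //.
  rewrite IE integralZl//.
  have -> : h (alpha x) = c^-1 * k x by rewrite kE mulrA mulVf// mul1r.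
  rewrite EFinM E muleDr ?fin_num_adde_defl// -EFinM mulrA mulVf// mul1r//.
Unshelve. all: by end_near. Qed.

End Conjugation.

(** * Null sets under the random map *)

Section NullFibers.
Context {R : realType} {d : measure_display} {Omega : measurableType d}.
Variable P : probability Omega R.
Variable phi : R -> Omega -> R.

(** The step functions [r n], which round down to the grid of mesh [1 / n.+1],
    tend to the identity, so [phi] is the pointwise limit of
    [phi (r n x) w], which are measurable because [r n] takes countably many
    values. *)
Lemma measurable_caratheodory : (forall w, continuous (phi ^~ w)) ->
  (forall x, measurable_fun setT (phi x)) ->
  measurable_fun setT (fun z : measurableTypeR R * Omega => phi z.1 z.2).
Proof.
move=> phic phim.
pose r (n : nat) (x : R) : R := (Num.floor (n.+1%:R * x))%:~R / n.+1%:R.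
have rx x : r n x @[n --> \oo] --> x.
  apply/cvgrPdist_le => /= e e0; near=> n.
  have n0 : (0 : R) < n.+1%:R by rewrite ltr0n.
  have [fl fu] : (Num.floor (n.+1%:R * x))%:~R <= n.+1%:R * x /\
    n.+1%:R * x < (Num.floor (n.+1%:R * x))%:~R + 1.
    split; first exact: floor_le.
    by rewrite -[X in _ + X]/(1%:~R) -intrD; exact: floorD1_gt.
  have en : 1 <= e * n.+1%:R.
    have en : e^-1 <= n%:R by near: n; exact: nbhs_infty_ger.
    by rewrite mulrC -ler_pdivrMr// mul1r (le_trans en)// ler_nat.
  have -> : x - r n x =
      (n.+1%:R * x - (Num.floor (n.+1%:R * x))%:~R) / n.+1%:R.
    by rewrite /r; field; rewrite lt0r_neq0.
  rewrite normrM (gtr0_norm (x := _^-1)) ?invr_gt0// ler_pdivrMr//.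
  by rewrite (le_trans _ en)// ger0_norm; lra.
apply: (@measurable_fun_cvg _ _ _ setT
  (fun n (z : measurableTypeR R * Omega) => phi (r n z.1) z.2)); last first.
  move=> [x w] _ /=; apply: (cvg_comp _ _ (rx x) (phic w x)).
move=> n _ B mB; rewrite setTI.
(* The union runs over the possible floors: [k] and a boolean for the sign. *)
have -> : (fun z : measurableTypeR R * Omega => phi (r n z.1) z.2) @^-1` B =
  \bigcup_k \bigcup_(b in [set: bool])
   ([set x | Num.floor (n.+1%:R * x) = (if b then Posz k else Negz k)] `*`
    (phi ((if b then Posz k else Negz k)%:~R / n.+1%:R) @^-1` B)).
  apply/seteqP; split=> [[x w] /= Bz|[x w] [k _ [b _ [/= xk]]]].
    move: Bz; rewrite /r; case jE : (Num.floor (n.+1%:R * x)) => [k|k] Bz.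
      by exists k => //; exists true.
    by exists k => //; exists false.
  by rewrite /r xk.
apply: bigcup_measurable => k _; apply: fin_bigcup_measurable => // b _.
apply: measurableX.
- set j := if b then _ else _.
  have -> : [set x | Num.floor (n.+1%:R * x) = j] =
     (fun x : R => n.+1%:R * x) @^-1` `[j%:~R, (j + 1)%:~R[%classic.
    apply/seteqP; split=> x /=; rewrite in_itv/=.
      by move=> <-; rewrite floor_le floorD1_gt.
    by move=> ?; exact: floor_def.
  rewrite -[X in measurable X]setTI; apply: measurable_funM => //.
- by rewrite -[X in measurable X]setTI; exact: phim.
Unshelve. all: by end_near. Qed.

(** By admissibility the points [(x, w)] at which [phi x w] falls in a given
    null set form a null set of the product; the product measure being the
    integral of the measures of the sections, almost all sections are null. *)
Lemma ae_fiber (Q : R -> Prop) : admissible P phi ->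
  (\forall y \ae lambda R, Q y) ->
  \forall x \ae lambda R, \forall w \ae P, Q (phi x w).
Proof.
move=> [phiD phim phi0] [A [mA A0 QA]].
have mphi := measurable_caratheodory (fun w => diffeo_continuous (phiD w)) phim.
pose Z := [set z : measurableTypeR R * Omega | A (phi z.1 z.2)].
have mZ : measurable Z by rewrite -[Z]setTI; exact: mphi.
have mPZ := measurable_fun_xsection P mZ.
have : (\int[lambda R]_x `|P (xsection Z x)| = 0)%E.
  rewrite -[RHS](phi0 A mA A0); apply: eq_integral => x _.
  by rewrite gee0_abs.
move/(ae_eq_integral_abs (lambda R) measurableT mPZ).1.
apply: filterS => x /(_ Logic.I) PZ.
exists (xsection Z x); split => //; first exact: measurable_xsection.
by move=> w /= nQ; rewrite /xsection /= inE; exact: QA.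
Qed.

End NullFibers.

(** * Essential supports *)

Section Supports.
Context {R : realType}.

Lemma ae_imply (Q Q' : R -> Prop) : (forall x, Q x -> Q' x) ->
  {ae lambda R, forall x, Q x} -> {ae lambda R, forall x, Q' x}.
Proof. exact: (@filterS _ _ (ae_filter_ringOfSetsType (lambda R))). Qed.

Lemma ae_imply2 (Q1 Q2 Q' : R -> Prop) : (forall x, Q1 x -> Q2 x -> Q' x) ->
  {ae lambda R, forall x, Q1 x} -> {ae lambda R, forall x, Q2 x} ->
  {ae lambda R, forall x, Q' x}.
Proof. exact: (@filterS2 _ _ (ae_filter_ringOfSetsType (lambda R))). Qed.

Lemma ae_imply4 (Q1 Q2 Q3 Q4 Q' : R -> Prop) :
  (forall x, Q1 x -> Q2 x -> Q3 x -> Q4 x -> Q' x) ->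
  {ae lambda R, forall x, Q1 x} -> {ae lambda R, forall x, Q2 x} ->
  {ae lambda R, forall x, Q3 x} -> {ae lambda R, forall x, Q4 x} ->
  {ae lambda R, forall x, Q' x}.
Proof.
move=> Q'P q1 q2 q3 q4.
have q12 : {ae lambda R, forall x, Q1 x /\ Q2 x}.
  by apply: ae_imply2 q1 q2 => x; split.
apply: (@filterS3 _ _ (ae_filter_ringOfSetsType (lambda R))) q12 q3 q4.
by move=> x [? ?]; exact: Q'P.
Qed.

(** A point outside the support has a rational interval around it on which [f]
    vanishes almost everywhere, and there are countably many of these. *)
Lemma ess_support_ae (f : R -> R) :
  \forall y \ae lambda R, ~ ess_support f y -> f y = 0.
Proof.
pose Q (n : nat) (y : R) := forall p q : rat,
  unpickle n = Some (p, q) ->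
  {ae lambda R, forall y, `]ratr p, ratr q[%classic y -> f y = 0} ->
  `]ratr p, ratr q[%classic y -> f y = 0.
have aeQ : \forall y \ae lambda R, forall n, Q n y.
  apply: ae_foralln => n; rewrite /Q.
  case: (unpickle n) => [[p q]|]; last exact: aeW.
  have [H|H] := pselect
      {ae lambda R, forall y, `]ratr p, ratr q[%classic y -> f y = 0}.
    by apply: ae_imply H => y Hy _ _ [<- <-] _.
  by apply: aeW => y _ _ [<- <-] /H.
apply: ae_imply aeQ => y Qy /existsNP[U /not_implyP[yU /contrapT fU]].
have [e /= e0 eU] := (@nbhs_ballP _ _ _ _).1 yU.
have [p] : exists p : rat, ratr p \in `]y - e, y[ by apply: rat_in_itvoo; lra.
have [q] : exists q : rat, ratr q \in `]y, y + e[ by apply: rat_in_itvoo; lra.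
rewrite !in_itv/= => /andP[yq qe] /andP[ep py].
apply: (Qy (pickle (p, q)) p q); rewrite ?pickleK//=; last first.
  by rewrite in_itv/= py.
apply: ae_imply fU => z fz /=; rewrite in_itv/= => /andP[pz zq]; apply: fz.
by apply: eU; rewrite /ball/= ltr_norml; apply/andP; split; lra.
Unshelve. all: by end_near. Qed.


Lemma closed_ess_support (f : R -> R) : closed (ess_support f).
Proof.
rewrite -[X in closed X]setCK; apply: open_closedC.
rewrite openE => x /existsNP[U /not_implyP[xU /contrapT fU]].
have : nbhs x (U°) by exact: nbhs_interior.
apply: filterS => y yU; apply/existsNP; exists U; apply/not_implyP; split=> //.
Qed.

Lemma ess_support_sub (f : R -> R) (F : set R) : closed F ->
  (forall y, ~ F y -> f y = 0) -> ess_support f `<=` F.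
Proof.
move=> cF f0 x; apply: contraPP => nFx /(_ (~` F)); apply.
- by apply: open_nbhs_nbhs; split=> //; exact: closed_openC.
- by apply: aeW => y; exact: f0.
Qed.

End Supports.

(** * Parametrizing the interior of an interval by the line *)

Section Parametrization.
Context {R : realType}.

(** Since [U] is open, [f] may be differentiated through any [f0] equal to it
    on [U]; this is how [pinv] is traded for an explicit inverse. *)
Lemma continuously_differentiable_on_eq (U : set R) (f f0 df : R -> R) :
  open U -> (forall x, U x -> f x = f0 x) ->
  (forall x, U x -> is_derive x 1 f0 (df x)) ->
  (forall x, U x -> {for x, continuous df}) ->
  continuously_differentiable_on U f.
Proof.
move=> oU ff0 f0D dfc.
have near_U x : U x -> \forall y \near x, U y.
  by move=> Ux; exact: open_nbhs_nbhs.
have f0f x : U x -> {near x, f0 =1 f}.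
  by move=> /near_U; apply: filterS => y /ff0.
have fE x : U x -> derive1 f x = df x.
  move=> Ux; rewrite derive1E -(near_eq_derive _ (f0f x Ux)).
  by have := f0D x Ux => ?; exact: derive_val.
move=> x Ux; split.
  apply: (near_eq_derivable (f0f x Ux)).
  by have := f0D x Ux => ?; exact: ex_derive.
rewrite /prop_for /continuous_at fE//.
have : {near x, df =1 derive1 f} by apply: filterS (near_U x Ux) => y /fE.
by move=> /near_eq_cvg /cvg_trans; apply; exact: dfc.
Qed.

(** Only [alpha] has to be differentiated: a continuous bijection with nonzero
    derivative has the inverse derivative [1 / (alpha' o beta)], which is
    continuous because [beta], being derivable, is. *)
Lemma diffeomorphism_can (V : set R) (alpha beta dalpha : R -> R) :
  open V -> (forall x, V (alpha x)) -> cancel alpha beta ->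
  (forall y, V y -> alpha (beta y) = y) ->
  (forall x : R, is_derive x 1 alpha (dalpha x)) -> continuous dalpha ->
  (forall x, dalpha x != 0) -> diffeomorphism setT V alpha.
Proof.
move=> oV Va aK bK da dac da0.
have ai : {in setT &, injective alpha} by move=> x y _ _; exact: (can_inj aK).
have ac : continuous alpha.
  move=> x; apply/differentiable_continuous/derivable1_diffP.
  by have := da x => ?; exact: ex_derive.
have dbeta y : V y -> is_derive y 1 beta (dalpha (beta y))^-1.
  move=> Vy; rewrite -[X in is_derive X](bK y Vy).
  apply: (@is_derive_inverse _ alpha beta) => //.
  - by near=> z; exact: aK.
  - by near=> z; exact: ac.
have bc y : V y -> {for y, continuous beta}.
  move=> Vy; apply/differentiable_continuous/derivable1_diffP.
  by have := dbeta y Vy => ?; exact: ex_derive.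
split.
- split; [by move=> x _; exact: Va|exact: ai|move=> y Vy].
  by exists (beta y) => //; exact: bK.
- apply: (@continuously_differentiable_on_eq setT alpha alpha dalpha).
  + exact: openT.
  + by [].
  + by move=> x _; exact: dac.
- apply: (@continuously_differentiable_on_eq V _ beta
    (fun y => (dalpha (beta y))^-1)) => //.
    by move=> y Vy; rewrite -{1}(bK y Vy) pinvKV//; exact/mem_set.
  move=> y Vy; apply: (@continuousV _ _ (dalpha \o beta)); first exact: da0.
  by apply: continuous_comp; [exact: bc|exact: dac].
Unshelve. all: by end_near. Qed.

Lemma diffeomorphism_ray_right (a : R) :
  diffeomorphism setT `]a, +oo[%classic (fun x => a + expR x).
Proof.
apply: (@diffeomorphism_can _ _ (fun y => ln (y - a)) expR).
- exact: interval_open.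
- by move=> x /=; rewrite in_itv/= andbT ltrDl expR_gt0.
- by move=> x /=; rewrite addrAC subrr add0r expRK.
- move=> y /=; rewrite in_itv/= andbT => ay.
  by rewrite lnK ?posrE ?subr_gt0// addrC subrK.
- by move=> x; apply: is_derive_eq; ring.
- exact: continuous_expR.
- by move=> x; rewrite gt_eqF// expR_gt0.
Qed.

Lemma diffeomorphism_ray_left (b : R) :
  diffeomorphism setT `]-oo, b[%classic (fun x => b - expR x).
Proof.
apply: (@diffeomorphism_can _ _ (fun y => ln (b - y)) (fun x => - expR x)).
- exact: interval_open.
- by move=> x /=; rewrite in_itv/= ltrBlDr ltrDl expR_gt0.
- by move=> x /=; rewrite opprB addrC subrK expRK.
- move=> y /=; rewrite in_itv/= => yb.
  by rewrite lnK ?posrE ?subr_gt0// subKr.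
- by move=> x; apply: is_derive_eq; ring.
- by move=> x; apply: continuousN; exact: continuous_expR.
- by move=> x; rewrite oppr_eq0 gt_eqF// expR_gt0.
Qed.

Lemma diffeomorphism_segment (a b : R) : a < b ->
  diffeomorphism setT `]a, b[%classic (fun x => a + (b - a) * (1 + expR x)^-1).
Proof.
move=> ab; have e0 (x : R) : 0 < expR x := @expR_gt0 R x.
have e1 (x : R) : 0 < 1 + expR x by exact: addr_gt0 ltr01 (e0 x).
have e1n (x : R) : 1 + expR x != 0 by rewrite gt_eqF.
apply: (@diffeomorphism_can _ _ (fun y => ln ((b - y) / (y - a)))
  (fun x => - (b - a) * expR x * (1 + expR x)^-1 * (1 + expR x)^-1)).
- exact: interval_open.
- move=> x /=; rewrite in_itv/= ltrDl mulr_gt0 ?invr_gt0 ?subr_gt0//=.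
  rewrite -ltrBrDl ltr_pdivrMr// ltr_pMr ?subr_gt0// ltrDl//.
- move=> x /=; rewrite -[RHS]expRK; congr ln.
  have ban : b - a != 0 by rewrite subr_eq0 gt_eqF.
  field; rewrite e1n /=.
  by rewrite (_ : _ + _ = b - a)//; ring.
- move=> y /=; rewrite in_itv/= => /andP[ay yb].
  rewrite lnK ?posrE ?divr_gt0 ?subr_gt0//.
  have yan : y - a != 0 by rewrite subr_eq0 gt_eqF.
  have ban : b - a != 0 by rewrite subr_eq0 gt_eqF.
  have -> : 1 + (b - y) / (y - a) = (b - a) / (y - a) by field.
  by field; rewrite yan ban.
- move=> x.
  have := e1n x => ?; apply: is_derive_eq.
  by rewrite /GRing.scale /=; field; exact: e1n.
- have eV : continuous (fun x : R => (1 + expR x)^-1).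
    move=> x; apply: (@continuousV _ _ (fun x => 1 + expR x)); first exact: e1n.
    by apply: continuousD; [exact: cst_continuous|exact: continuous_expR].
  move=> x; apply: cvgM; last exact: eV.
  apply: cvgM; last exact: eV.
  by apply: cvgM; [exact: cvg_cst|exact: continuous_expR].
- by move=> x; rewrite !mulf_neq0// ?oppr_eq0 ?invr_eq0// ?subr_eq0 gt_eqF.
Qed.

(** Interiors of nondegenerate intervals are the four shapes of open interval;
    the bounds on [F] leave at most the end points outside the interior. *)
Lemma interval_interior_itv (F : set R) : is_interval F ->
  (exists a b, [/\ F a, F b & a < b]) ->
  [\/ F° = setT,
      exists2 a, F° = `]a, +oo[%classic & F `<=` `[a, +oo[,
      exists2 b, F° = `]-oo, b[%classic & F `<=` `]-oo, b] |
      exists a b, [/\ a < b, F° = `]a, b[%classic & F `<=` `[a, b]]].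
Proof.
move=> /is_intervalP FE [x [y [Fx Fy xy]]].
have {}Fx : x \in Rhull F by move: Fx; rewrite {1}FE.
have {}Fy : y \in Rhull F by move: Fy; rewrite {1}FE.
case: (Rhull F) FE Fx Fy => -[ba a|[]] [bb b|[]] -> /=; rewrite ?in_itv//=.
all: rewrite ?andbF//= ?interior_itv.
- move=> /andP[ax xb] /andP[ay yb]; apply: Or44; exists a, b; split=> //.
  + exact: le_lt_trans (lteifW ax) (lt_le_trans xy (lteifW yb)).
  + by move=> z /=; rewrite !in_itv/= => /andP[/lteifW -> /lteifW ->].
- move=> _ _; apply: Or42; exists a => // z /=.
  by rewrite !in_itv/= !andbT => /lteifW.
- move=> _ _; apply: Or43; exists b => // z /=.
  by rewrite !in_itv/= => /lteifW.
- by move=> _ _; apply: Or41; rewrite set_itvE.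
Qed.

Lemma diffeomorphism_interior (F : set R) : is_interval F ->
  (exists a b, [/\ F a, F b & a < b]) ->
  exists alpha, diffeomorphism setT F° alpha.
Proof.
move=> iF F2; have [->|[a -> _]|[b -> _]|[a [b [ab -> _]]]] :=
  interval_interior_itv iF F2.
- exists id; apply: (@diffeomorphism_can _ _ id (cst 1)) => //.
  + exact: openT.
  + exact: cst_continuous.
  + by move=> x; rewrite oner_neq0.
- by eexists; exact: diffeomorphism_ray_right.
- by eexists; exact: diffeomorphism_ray_left.
- by eexists; exact: diffeomorphism_segment.
Qed.

Lemma ae_interior (F : set R) : is_interval F ->
  (exists a b, [/\ F a, F b & a < b]) ->
  {ae lambda R, forall y, F y -> F° y}.
Proof.
move=> iF F2.
suff [a [b Fab]] : exists a b, F `\` F° `<=` [set a] `|` [set b].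
  have : (lambda R).-negligible ([set a] `|` [set b]).
    apply: negligibleU; apply/negligibleP => //; exact: lebesgue_measure_set1.
  by apply: negligibleS => y /= /not_implyP; exact: Fab.
have [->|[a -> Fa]|[b -> Fb]|[a [b [ab -> Fab]]]] := interval_interior_itv iF F2.
- by exists 0, 0 => y [_ /(_ Logic.I)].
- exists a, a => y [/Fa] /=; rewrite !in_itv/= !andbT le_eqVlt.
  by case/predU1P => [->|-> /(_ isT)//]; left.
- exists b, b => y [/Fb] /=; rewrite !in_itv/= le_eqVlt.
  by case/predU1P => [->|-> /(_ isT)//]; left.
- exists a, b => y [/Fab] /=; rewrite !in_itv/= !le_eqVlt.
  move=> /andP[/predU1P[->|->]]; first by left.
  by case/predU1P => [->|-> /(_ isT)//]; right.
Qed.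

End Parametrization.

(** * Transfer of solutions *)

Section SolutionTransfer.
Context {R : realType} {d : measure_display} {Omega : measurableType d}.
Variable P : probability Omega R.
Hypothesis P_complete : measure_is_complete P.
Variables (g : R -> R) (phi : R -> Omega -> R) (F : set R).
Hypothesis phi_adm : admissible P phi.
Hypothesis phi_F : {ae P, forall w, (phi ^~ w) @` F° = F°}.

Let phiD w : diffeomorphism setT setT (phi ^~ w).
Proof. by case: phi_adm. Qed.

(** Every representative [k] of [|alpha'| (f o alpha)] comes from a
    representative [h] of [f], obtained by transporting [k] back to the interior
    of [F] and keeping [f] elsewhere; the equation for [h] at almost every
    [alpha x] is the one for [k] at [x]. *)
Lemma conjugate_solution (alpha f : R -> R) (psi : R -> Omega -> R) :
  diffeomorphism setT F° alpha -> conjugate_by P alpha phi psi ->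
  L1_solution P phi g f ->
  L1_solution P psi (fun x => `|derive1 alpha x| * g (alpha x))
    (fun x => `|derive1 alpha x| * f (alpha x)).
Proof.
move=> alphaD psiE [f_L1 fS]; have V_open := @open_interior _ F.
split; first exact (L1_pullback V_open alphaD f_L1).
move=> k kf.
pose h : R -> R := patch f F°
  (fun y => `|derive1 (pinv (@setT R) alpha) y| * k (pinv (@setT R) alpha y)).
have jac0 x : `|derive1 alpha x| != 0.
  by rewrite gt_eqF//; exact: jacobian_gt0 alphaD _.
have kE x : k x = `|derive1 alpha x| * h (alpha x).
  rewrite /h /patch mem_set; last exact: diffeo_mem alphaD _.
  by rewrite (jacobianV alphaD) (diffeoK alphaD) mulrA mulfV// mul1r.
have hf : h = f %[ae lambda R].
  suff : {ae lambda R, forall y, F° y -> h y = f y}.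
    apply: ae_imply => y Vhf _; have [/Vhf//|yV] := pselect (F° y).
    by rewrite /h /patch memNset.
  apply: (ae_diffeo_comp V_open alphaD).
  apply: ae_imply kf => x /(_ Logic.I) kfx.
  by apply: (mulfI (jac0 x)); rewrite -kE.
move: (ae_comp_diffeo V_open alphaD (fS h hf)); apply: ae_imply => x.
by move/(equation_at_conjugate P_complete alphaD g phiD phi_F psiE x kE).
Qed.

(** Inside [F] the equation is transported pointwise. Outside the interior all
    three terms vanish: almost every [y] there avoids [F] and hence the support
    of [g]; and [phi y w] stays outside the interior because [phi ^~ w] is
    injective and already maps the interior onto itself, so any representative
    [h] of the extension by zero is zero at [phi y w] for almost all [w]. *)
Lemma unconjugate_solution (alpha f : R -> R) (psi : R -> Omega -> R) :
  is_interval F -> (exists a b, [/\ F a, F b & a < b]) ->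
  ess_support g `<=` F ->
  diffeomorphism setT F° alpha -> conjugate_by P alpha phi psi ->
  L1_solution P psi (fun x => `|derive1 alpha x| * g (alpha x)) f ->
  L1_solution P phi g (patch (fun=> 0) F°
    (fun y => `|derive1 (pinv (@setT R) alpha) y| * f (pinv (@setT R) alpha y))).
Proof.
move=> iF F2 gF alphaD psiE [f_L1 fS]; have V_open := @open_interior _ F.
split; first exact (L1_pushforward V_open alphaD f_L1).
set f0 := patch _ _ _ => h hf.
have f0N y : ~ F° y -> f0 y = 0 by move=> yV; rewrite /f0 /patch memNset.
have hf' : {ae lambda R, forall y, h y = f0 y}.
  by apply: ae_imply hf => y /(_ Logic.I).
pose k x := `|derive1 alpha x| * h (alpha x).
have kf : k = f %[ae lambda R].
  move: (ae_comp_diffeo V_open alphaD hf'); apply: ae_imply => x hfx _.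
  rewrite /k hfx /f0 /patch mem_set; last exact: diffeo_mem alphaD _.
  rewrite (jacobianV alphaD) (diffeoK alphaD) mulrA mulfV ?mul1r//.
  by rewrite gt_eqF//; exact: jacobian_gt0 alphaD _.
have inside : {ae lambda R, forall y, F° y -> equation_at P phi g h y}.
  apply: (ae_diffeo_comp V_open alphaD).
  move: (fS k kf); apply: ae_imply => x.
  by move/(equation_at_conjugate P_complete alphaD g phiD phi_F psiE x
    (fun=> erefl)).
have outside : {ae lambda R, forall y, ~ F° y -> equation_at P phi g h y}.
  have := ae_fiber phi_adm hf'.
  move: hf' (ess_support_ae g) (ae_interior iF F2).
  apply: ae_imply4 => y hy gy Fy hphi yV.
  have g0 : g y = 0 by apply: gy => /gF/Fy.
  rewrite /equation_at hy f0N// g0 adde0.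
  set I := fun w => _.
  have I0 : cst 0%E = I %[ae P].
    near=> w => _; rewrite /I.
    have -> : h (phi y w) = f0 (phi y w) by near: w.
    rewrite f0N ?mulr0// => phiV.
    have phi_V : (phi ^~ w) @` F° = F° by near: w.
    apply: yV; move: phiV; rewrite -{1}phi_V => -[z zV].
    by move/(diffeo_inj (phiD w)) => <-.
  have [iI ->] := integrable_ae_eq P_complete I0 (integrable0 _ _).
  by split=> //; rewrite integral0.
move: inside outside; apply: ae_imply2 => y inV outV.
by have [/inV|/outV] := pselect (F° y).
Unshelve. all: by end_near. Qed.

End SolutionTransfer.

Lemma compact_ess_support (R : realType) (f : R -> R) (F : set R) :
  bounded_set F -> ess_support f `<=` F -> compact (ess_support f).
Proof.
move=> [M [_ FM]] fF.
apply: (@subclosed_compact _ _ `[- (M + 1), M + 1]%classic).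
- exact: closed_ess_support.
- exact: segment_compact.
- move=> y /fF Fy /=; rewrite in_itv/= -ler_norml.
  by apply: FM Fy; rewrite ltrDl.
Qed.

Unset Implicit Arguments.

Theorem theorem3p2 (R : realType) (d : measure_display)
    (Omega : measurableType d) (P : probability Omega R)
    (P_complete : measure_is_complete P)
    (g : R -> R) (g_L1 : L1 g)
    (phi : R -> Omega -> R) (phi_adm : admissible P phi)
    (F : set R) (F_closed : closed F) (F_interval : is_interval F)
    (F_nondegenerate : exists a b, [/\ F a, F b & a < b])
    (supp_g : ess_support g `<=` F)
    (phi_F : {ae P, forall w, (phi ^~ w) @` F° = F°}) :
  (bounded_set F ->
     (compact_solution_within P phi g F <->
      solution_after_conjugation P phi g F)) /\
  (compact_solution_within P phi g F -> solution_after_conjugation P phi g F).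
Proof.
have forward : compact_solution_within P phi g F ->
    solution_after_conjugation P phi g F.
  move=> [f [fS _ _]].
  have [alpha alphaD] := diffeomorphism_interior F_interval F_nondegenerate.
  pose psi x w := pinv setT alpha (phi (alpha x) w).
  have psiE : conjugate_by P alpha phi psi by exact: aeW.
  exists alpha; split=> //; exists psi; split=> //.
  exists (fun x => `|derive1 alpha x| * f (alpha x)).
  exact: (conjugate_solution P_complete phi_adm phi_F alphaD psiE fS).
split=> // F_bounded; split=> // -[alpha [alphaD [psi [psiE [f fS]]]]].
have f0S := unconjugate_solution P_complete phi_adm phi_F F_interval
  F_nondegenerate supp_g alphaD psiE fS.
set f0 := patch _ _ _ in f0S.
have f0F : ess_support f0 `<=` F.
  apply: ess_support_sub => // y nFy; rewrite /f0 /patch memNset//.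
  by move/interior_subset/nFy.
by exists f0; split=> //; exact: compact_ess_support f0F.
Qed.
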